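(* Assume that $S_1$, $S_2$ and $S_3$ are all invertible, and let $$\mathcal{P}_{T_1}=\begin{bmatrix} A_1 & 0 & 0\\ C_1 & -S_2 & 0\\ 0 & C_2 & S_3\end{bmatrix}.$$ Then $$\mathcal{P}_{T_1}^{-1}\mathcal{A}=\mathcal{U}:=\begin{bmatrix} I & A_1^{-1}B_1^T & 0\\ 0 & I & -S_2^{-1}B_2^T\\ 0&0&I\end{bmatrix},$$ and $\mathcal{P}_{T_1}^{-1}\mathcal{A}$ satisfies the polynomial equation $(\lambda-1)^3=0$, i.e. $(\mathcal{P}_{T_1}^{-1}\mathcal{A}-I)^3=0$. If, in addition, $B_1^TS_2^{-1}B_2^T$ is nonzero, then $(\lambda-1)^3$ is the minimal polynomial of $\mathcal{P}_{T_1}^{-1}\mathcal{A}$.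
   Context: Let $n_1,n_2,n_3\ge 1$. $A_i$ is a real $n_i\times n_i$ matrix ($i=1,2,3$), $B_1,C_1$ are real $n_2\times n_1$ matrices, and $B_2,C_2$ are real $n_3\times n_2$ matrices. No symmetry or definiteness is assumed. The twofold saddle point matrix is $$\mathcal{A}=\begin{bmatrix} A_1 & B_1^T & 0\\ C_1 & -A_2 & B_2^T\\ 0 & C_2 & A_3\end{bmatrix}.$$ The nested Schur complements are defined by $S_1=A_1$, $S_2=A_2+C_1S_1^{-1}B_1^T$, $S_3=A_3+C_2S_2^{-1}B_2^T$ (each defined when the preceding one is invertible). $I$ denotes identity matrices of the appropriate sizes. *)

(* Defs.v *)
From mathcomp Require Import all_boot all_order all_algebra.
From mathcomp Require Import reals.
Set Implicit Arguments.
Unset Strict Implicit.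
Unset Printing Implicit Defensive.

Import GRing.Theory.
Local Open Scope ring_scope.

Definition block3_mx (R : Type) (m1 m2 m3 n1 n2 n3 : nat)
    (M11 : 'M[R]_(m1, n1)) (M12 : 'M[R]_(m1, n2)) (M13 : 'M[R]_(m1, n3))
    (M21 : 'M[R]_(m2, n1)) (M22 : 'M[R]_(m2, n2)) (M23 : 'M[R]_(m2, n3))
    (M31 : 'M[R]_(m3, n1)) (M32 : 'M[R]_(m3, n2)) (M33 : 'M[R]_(m3, n3)) :
    'M[R]_(m1 + (m2 + m3), n1 + (n2 + n3)) :=
  block_mx M11 (row_mx M12 M13)
           (col_mx M21 M31) (block_mx M22 M23 M32 M33).

Section TwofoldSaddlePoint.
Variables (R : realType) (n1 n2 n3 : nat).
Variables (A1 : 'M[R]_n1) (A2 : 'M[R]_n2) (A3 : 'M[R]_n3).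
Variables (B1 C1 : 'M[R]_(n2, n1)) (B2 C2 : 'M[R]_(n3, n2)).

Definition saddle_mx : 'M[R]_(n1 + (n2 + n3)) :=
  block3_mx A1 B1^T   0
            C1 (- A2) B2^T
            0  C2     A3.

(* [invmx] is the identity on singular matrices, so [schur2] (resp. [schur3])
   is the nested Schur complement only when the preceding one is invertible. *)
Definition schur1 : 'M[R]_n1 := A1.
Definition schur2 : 'M[R]_n2 := A2 + C1 *m invmx schur1 *m B1^T.
Definition schur3 : 'M[R]_n3 := A3 + C2 *m invmx schur2 *m B2^T.

Definition precond_T1 : 'M[R]_(n1 + (n2 + n3)) :=
  block3_mx A1 0          0
            C1 (- schur2) 0
            0  C2         schur3.

Definition upper_U : 'M[R]_(n1 + (n2 + n3)) :=
  block3_mx 1%:M (invmx A1 *m B1^T) 0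
            0    1%:M               (- (invmx schur2 *m B2^T))
            0    0                  1%:M.

End TwofoldSaddlePoint.

(* Main.v *)
Require Import Defs.
From mathcomp Require Import all_boot all_order all_algebra.
From mathcomp Require Import reals.
Set Implicit Arguments.
Unset Strict Implicit.
Unset Printing Implicit Defensive.
Import GRing.Theory.
Local Open Scope ring_scope.

(* The factorization A = P U with P block lower triangular and U block upper
   unitriangular is a block LU decomposition, so invmx P *m A = U.  The block
   strictly upper triangular matrix N = U - 1 satisfies N^3 = 0, and the only
   possibly nonzero block of N^2 is - A1^-1 B1^T S2^-1 B2^T; when it does not
   vanish, no proper divisor of ('X - 1)^3 annihilates U. *)

(** The minimal polynomial divides [('X - a%:P) ^+ k.+1], so it is a power of ['X - a%:P]; an
    exponent at most [k] would annihilate [(M - a%:M) ^+ k]. *)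
Lemma mxminpoly_XsubC_exp (F : fieldType) (n k : nat) (M : 'M[F]_n.+1) (a : F) :
    (M - a%:M) ^+ k.+1 = 0 -> (M - a%:M) ^+ k != 0 ->
  mxminpoly M = ('X - a%:P) ^+ k.+1.
Proof.
have hE j : horner_mx M (('X - a%:P) ^+ j) = (M - a%:M) ^+ j.
  by rewrite rmorphXn rmorphB /= horner_mx_X horner_mx_C.
move=> Mk0 MkN0; have /dvdp_exp_XsubCP[j le_jk eq_j] :
  mxminpoly M %| ('X - a%:P) ^+ k.+1 by apply: mxminpoly_min; rewrite hE.
have {}eq_j : mxminpoly M = ('X - a%:P) ^+ j.
  (* Divisibility gives the power only up to a scalar factor; both sides being monic makes it an
     equality. *)
  by apply/eqP; rewrite -eqp_monic ?mxminpoly_monic ?monic_exp ?monicXsubC.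
have Mj0 : (M - a%:M) ^+ j = 0 by rewrite -hE -eq_j mx_root_minpoly.
suff /eqP <- : j == k.+1 by [].
rewrite eqn_leq le_jk ltnNge; apply: contra MkN0 => le_jk'.
by rewrite -(subnK le_jk') exprD Mj0 mulr0.
Qed.

Section Block3.
Variables (R : pzRingType) (m1 m2 m3 n1 n2 n3 p1 p2 p3 : nat).

Lemma mulmx_block3
    (A11 : 'M[R]_(m1, n1)) (A12 : 'M[R]_(m1, n2)) (A13 : 'M[R]_(m1, n3))
    (A21 : 'M[R]_(m2, n1)) (A22 : 'M[R]_(m2, n2)) (A23 : 'M[R]_(m2, n3))
    (A31 : 'M[R]_(m3, n1)) (A32 : 'M[R]_(m3, n2)) (A33 : 'M[R]_(m3, n3))
    (B11 : 'M[R]_(n1, p1)) (B12 : 'M[R]_(n1, p2)) (B13 : 'M[R]_(n1, p3))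
    (B21 : 'M[R]_(n2, p1)) (B22 : 'M[R]_(n2, p2)) (B23 : 'M[R]_(n2, p3))
    (B31 : 'M[R]_(n3, p1)) (B32 : 'M[R]_(n3, p2)) (B33 : 'M[R]_(n3, p3)) :
  block3_mx A11 A12 A13 A21 A22 A23 A31 A32 A33
    *m block3_mx B11 B12 B13 B21 B22 B23 B31 B32 B33 =
  block3_mx
    (A11 *m B11 + (A12 *m B21 + A13 *m B31))
    (A11 *m B12 + (A12 *m B22 + A13 *m B32))
    (A11 *m B13 + (A12 *m B23 + A13 *m B33))
    (A21 *m B11 + (A22 *m B21 + A23 *m B31))
    (A21 *m B12 + (A22 *m B22 + A23 *m B32))
    (A21 *m B13 + (A22 *m B23 + A23 *m B33))
    (A31 *m B11 + (A32 *m B21 + A33 *m B31))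
    (A31 *m B12 + (A32 *m B22 + A33 *m B32))
    (A31 *m B13 + (A32 *m B23 + A33 *m B33)).
Proof.
rewrite /block3_mx mulmx_block mul_row_col mul_mx_row mul_row_block add_row_mx.
rewrite mul_col_mx mul_block_col add_col_mx mulmx_block mul_col_row.
by rewrite add_block_mx.
Qed.

Lemma block3_mx0 :
  block3_mx 0 0 0 0 0 0 0 0 0 = 0 :> 'M[R]_(m1 + (m2 + m3), n1 + (n2 + n3)).
Proof. by rewrite /block3_mx row_mx0 col_mx0 !block_mx0. Qed.

End Block3.

(** The determinant is the product of those of the diagonal blocks. *)
Lemma block3_mx_ltriang_unit (R : comUnitRingType) (n1 n2 n3 : nat)
    (L11 : 'M[R]_n1) (L21 : 'M[R]_(n2, n1)) (L22 : 'M[R]_n2)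
    (L31 : 'M[R]_(n3, n1)) (L32 : 'M[R]_(n3, n2)) (L33 : 'M[R]_n3) :
  (block3_mx L11 0 0 L21 L22 0 L31 L32 L33 \in unitmx)
    = [&& L11 \in unitmx, L22 \in unitmx & L33 \in unitmx].
Proof. by rewrite /block3_mx row_mx0 !unitmxE !det_lblock !unitrM. Qed.

Section UnitUpper.
Variables (R : pzRingType) (n1 n2 n3 : nat).
Variables (X : 'M[R]_(n1, n2)) (Y : 'M[R]_(n2, n3)).

Let N : 'M[R]_(n1 + (n2 + n3)) := block3_mx 0 X 0 0 0 Y 0 0 0.

Lemma block3_mx_unitriang_sub1 :
  block3_mx 1%:M X 0 0 1%:M Y 0 0 1%:M - 1%:M = N.
Proof.
rewrite /N /block3_mx !scalar_mx_block !opp_block_mx !add_block_mx !subrr.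
by rewrite !oppr0 !addr0.
Qed.

Lemma block3_mx_striang_sqr :
  N *m N = block3_mx 0 0 (X *m Y) 0 0 0 0 0 0.
Proof. by rewrite mulmx_block3 !(mul0mx, mulmx0, add0r, addr0). Qed.

(** The product is nested to the right, the shape in which [exprS] unfolds a cube. *)
Lemma block3_mx_striang_cube : N *m (N *m N) = 0.
Proof.
rewrite block3_mx_striang_sqr mulmx_block3 !(mul0mx, mulmx0, add0r, addr0).
exact: block3_mx0.
Qed.

End UnitUpper.

Lemma precond_T1_mul_upper_U (R : realType) (n1 n2 n3 : nat)
    (A1 : 'M[R]_n1) (A2 : 'M[R]_n2) (A3 : 'M[R]_n3)
    (B1 C1 : 'M[R]_(n2, n1)) (B2 C2 : 'M[R]_(n3, n2)) :
    schur1 A1 \in unitmx -> schur2 A1 A2 B1 C1 \in unitmx ->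
  precond_T1 A1 A2 A3 B1 C1 B2 C2 *m upper_U A1 A2 B1 C1 B2
    = saddle_mx A1 A2 A3 B1 C1 B2 C2.
Proof.
rewrite /schur1 => uA1 uS2; rewrite mulmx_block3.
rewrite !(mul0mx, mulmx0, add0r, addr0, mulmx1, mulmxN, mulNmx, opprK).
rewrite !mulmxA !mulmxV // !mul1mx /saddle_mx; congr block3_mx.
  (* Block (2,2): the Schur correction in [- schur2] cancels [C1 *m invmx A1 *m B1^T]. *)
  by rewrite /schur2 /schur1 opprD addrCA subrr addr0.
(* Block (3,3): the same cancellation against the correction in [schur3]. *)
by rewrite /schur3 addrCA addNr addr0.
Qed.

Theorem theorem2p1 (R : realType) (n1 n2 n3 : nat)
    (A1 : 'M[R]_n1.+1) (A2 : 'M[R]_n2.+1) (A3 : 'M[R]_n3.+1)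
    (B1 C1 : 'M[R]_(n2.+1, n1.+1)) (B2 C2 : 'M[R]_(n3.+1, n2.+1))
    (hS1 : schur1 A1 \in unitmx)
    (hS2 : schur2 A1 A2 B1 C1 \in unitmx)
    (hS3 : schur3 A1 A2 A3 B1 C1 B2 C2 \in unitmx) :
  let A := saddle_mx A1 A2 A3 B1 C1 B2 C2 in
  let S2 := schur2 A1 A2 B1 C1 in
  let P := precond_T1 A1 A2 A3 B1 C1 B2 C2 in
  let U := upper_U A1 A2 B1 C1 B2 in
  [/\ P \in unitmx,
      invmx P *m A = U,
      (invmx P *m A - 1%:M) ^+ 3 = 0
    & B1^T *m invmx S2 *m B2^T != 0 ->
      mxminpoly (invmx P *m A) = ('X - 1%:P) ^+ 3].
Proof.
move=> A S2 P U.
have uP : P \in unitmx.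
  rewrite block3_mx_ltriang_unit -[A1]/(schur1 A1) hS1 hS3 andbT /=.
  (* The middle diagonal block is [- S2], a multiple of [S2] by the unit -1. *)
  by rewrite -scaleN1r unitmxZ ?unitrN1.
have PA_U : invmx P *m A = U by rewrite /A -precond_T1_mul_upper_U // mulKmx.
set X := invmx A1 *m B1^T; set Y := - (invmx S2 *m B2^T).
have U_sub1 : U - 1%:M = block3_mx 0 X 0 0 0 Y 0 0 0.
  exact: block3_mx_unitriang_sub1.
have U3 : (U - 1%:M) ^+ 3 = 0.
  by rewrite U_sub1 !exprS expr0 mulr1 (block3_mx_striang_cube X Y : _ * _ = 0).
split; rewrite ?PA_U // => S2N0; apply: mxminpoly_XsubC_exp => //.
rewrite U_sub1 expr2.
apply: contra S2N0 => /eqP N2_0.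
have := etrans (esym (block3_mx_striang_sqr X Y)) N2_0.
(* The zero is retyped at the block size and split into blocks, so that block (1,3) of the square
   yields [X *m Y = 0]. *)
rewrite -[RHS]/(0 : 'M_(n1.+1 + (n2.+1 + n3.+1))) -block3_mx0.
case/eq_block_mx => _ /eq_row_mx[_ +] _ _.
rewrite mulmxN => /eqP; rewrite oppr_eq0 => /eqP XY0.
(* Left multiplication by [A1] undoes the factor [invmx A1] in [X]. *)
suff -> : B1^T *m invmx S2 *m B2^T = A1 *m (X *m (invmx S2 *m B2^T)).
  by rewrite XY0 mulmx0.
by rewrite !mulmxA mulmxV // mul1mx.
Qed.
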